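(* For every $k\ge 0$, the unique minimizer $t_k^{\rm TAS}$ of $g_k$ over $[0,1]$ satisfies $$t_k^{\rm TAS}\in\mathcal{C}_k\cap[0,1].$$
   Context: Notation: $\langle m\rangle=\{1,2,\dots,m\}$; $\langle\cdot,\cdot\rangle$ and $\|\cdot\|$ are the standard inner product and Euclidean norm on $\mathbb{R}^n$. Problem: $F=(f_1,\dots,f_m)^\top:\mathbb{R}^n\to\mathbb{R}^m$ is continuously differentiable and $\Omega\subset\mathbb{R}^n$ is a nonempty compact convex set. For each $i\in\langle m\rangle$ there is a constant $L_i>0$ with $\|\nabla f_i(x)-\nabla f_i(y)\|\le L_i\|x-y\|$ for all $x,y\in\Omega$. For $x\in\Omega$, let $p(x)\in\arg\min_{p\in\Omega}\max_{i\in\langle m\rangle}\langle\nabla f_i(x),p-x\rangle$ (some minimizer), $d(x)=p(x)-x$, and $\theta(x)=\max_{i\in\langle m\rangle}\langle\nabla f_i(x),p(x)-x\rangle$. The multiobjective conditional gradient (MCondG) algorithm starts from $x^0\in\Omega$ and iterates $x^{k+1}=x^k+t_kd^k$ with $d^k=d(x^k)$ and a step size $t_k\in(0,1]$; it stops if $\theta(x^k)=0$. It is assumed that it does not terminate, i.e. $\theta(x^k)<0$ for all $k\ge0$ (in particular $d^k\neq0$). For $t\in[0,1]$ define $$g_{i,k}(t)=\tfrac12L_i\|d^k\|^2t^2+\langle\nabla f_i(x^k),d^k\rangle t\quad(i\in\langle m\rangle),\qquad g_k(t)=\max_{i\in\langle m\rangle}g_{i,k}(t).$$ The function $g_k$ has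 a unique minimizer over $[0,1]$, denoted $t_k^{\rm TAS}$. Define the finite sets $$M_k=\left\{-\frac{\langle\nabla f_i(x^k),d^k\rangle}{L_i\|d^k\|^2}: i\in\langle m\rangle\right\},$$ $$I_k=\left\{-\frac{2\langle\nabla f_i(x^k)-\nabla f_j(x^k),d^k\rangle}{(L_i-L_j)\|d^k\|^2}: i,j\in\langle m\rangle,\ i<j,\ L_i\ne L_j\right\},$$ and $\mathcal{C}_k=\{1\}\cup M_k\cup I_k$. *)

(* Defs.v *)
From HB Require Import structures.
From mathcomp Require Import all_boot all_order all_algebra.
From mathcomp Require Import all_classical all_reals all_analysis.

Set Implicit Arguments.
Unset Strict Implicit.
Unset Printing Implicit Defensive.

Import Order.TTheory GRing.Theory Num.Theory.
Import numFieldNormedType.Exports.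

Local Open Scope classical_set_scope.
Local Open Scope ring_scope.

(* The library norm on ['rV[R]_n] is the sup norm (it induces the usual
   topology), so the Euclidean structure is given separately. *)
Definition dotp (R : realType) (n : nat) (u v : 'rV[R]_n) : R :=
  \sum_(j < n) u ord0 j * v ord0 j.

Definition enorm (R : realType) (n : nat) (u : 'rV[R]_n) : R :=
  Num.sqrt (dotp u u).

Definition grad (R : realType) (n : nat) (f : 'rV[R]_n -> R) (x : 'rV[R]_n) :
    'rV[R]_n :=
  \row_(j < n) 'D_(delta_mx ord0 j) f x.

Definition component (R : realType) (n m : nat) (F : 'rV[R]_n -> 'rV[R]_m)
    (i : 'I_m) : 'rV[R]_n -> R :=
  fun x => F x ord0 i.

Definition continuously_differentiable (R : realType) (n m : nat)
    (F : 'rV[R]_n -> 'rV[R]_m) : Prop :=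
  (forall x, differentiable F x) /\ continuous (jacobian F).

(* The family is indexed by ['I_m.+1], hence nonempty; seeding the iterated
   maximum with one of its own values makes it the maximum of the family. *)
Definition maxf (R : realType) (m : nat) (h : 'I_m.+1 -> R) : R :=
  \big[Num.max/h ord0]_(i < m.+1) h i.

Definition argmin (R : realType) (T : Type) (D : set T) (h : T -> R) : set T :=
  [set x | D x /\ forall y, D y -> h x <= h y].

Section MCondG.
Variables (R : realType) (n m : nat).
Variable F : 'rV[R]_n -> 'rV[R]_m.+1.

Definition slope (x d : 'rV[R]_n) (i : 'I_m.+1) : R :=
  dotp (grad (component F i) x) d.

Definition max_slope (x d : 'rV[R]_n) : R := maxf (slope x d).

Definition is_selection (Omega : set 'rV[R]_n) (p : 'rV[R]_n -> 'rV[R]_n) :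
    Prop :=
  forall x, Omega x -> argmin Omega (fun q => max_slope x (q - x)) (p x).

Definition direction (p : 'rV[R]_n -> 'rV[R]_n) (x : 'rV[R]_n) : 'rV[R]_n :=
  p x - x.

Definition theta (p : 'rV[R]_n -> 'rV[R]_n) (x : 'rV[R]_n) : R :=
  max_slope x (p x - x).

Definition MCondG_sequence (Omega : set 'rV[R]_n) (p : 'rV[R]_n -> 'rV[R]_n)
    (x : nat -> 'rV[R]_n) (t : nat -> R) : Prop :=
  [/\ Omega (x 0%N),
      forall k, 0 < t k <= 1
    & forall k, x k.+1 = x k + t k *: direction p (x k)].

Variable L : 'I_m.+1 -> R.

Definition g_comp (x d : 'rV[R]_n) (i : 'I_m.+1) (s : R) : R :=
  2^-1 * L i * enorm d ^+ 2 * s ^+ 2 + slope x d i * s.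

Definition g_max (x d : 'rV[R]_n) (s : R) : R :=
  maxf (fun i => g_comp x d i s).

Definition M_set (x d : 'rV[R]_n) : set R :=
  [set - (slope x d i / (L i * enorm d ^+ 2)) | i in [set: 'I_m.+1]].

Definition I_set (x d : 'rV[R]_n) : set R :=
  [set r | exists i j : 'I_m.+1, [/\ (i < j)%N, L i != L j &
    r = - (2 * dotp (grad (component F i) x - grad (component F j) x) d
           / ((L i - L j) * enorm d ^+ 2))]].

Definition C_set (x d : 'rV[R]_n) : set R :=
  [set 1] `|` M_set x d `|` I_set x d.

End MCondG.

(* Main.v *)
(* Nontermination makes every slope negative, so g is a maximum of finitely many
   strictly convex quadratics vanishing at 0 with negative slope there; it has a
   unique minimizer t, and t > 0. If t < 1, either some piece active at t is
   stationary there, or two active pieces with different leading coefficients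
   cross at t: otherwise all the active pieces coincide and are strictly monotone
   at t, so a small move of t decreases g. *)
Require Import Defs.
From HB Require Import structures.
From mathcomp Require Import all_boot all_order all_algebra.
From mathcomp Require Import all_classical all_reals all_analysis.
From mathcomp Require Import ring lra.

Set Implicit Arguments.
Unset Strict Implicit.
Unset Printing Implicit Defensive.

Import Order.TTheory GRing.Theory Num.Theory.
Import numFieldNormedType.Exports.

Local Open Scope classical_set_scope.
Local Open Scope ring_scope.

Section Maxf.
Variables (R : realType) (m : nat).
Implicit Type h : 'I_m.+1 -> R.

Lemma maxf_ge h i : h i <= maxf h.
Proof. exact: le_bigmax_seq (mem_index_enum i) _. Qed.

Lemma maxf_attained h : exists i, maxf h = h i.
Proof.
rewrite /maxf; elim/big_ind: _ => [|_ _ [i ->] [j ->]|i _]; first by exists ord0.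
- by case: (leP (h i) (h j)) => _; [exists j | exists i].
- by exists i.
Qed.

Lemma continuous_maxf (h : 'I_m.+1 -> R -> R) :
  (forall i, continuous (h i)) -> continuous (fun s => maxf (h^~ s)).
Proof.
move=> h_cont; rewrite /maxf; elim: (index_enum _) => [|i r IHr].
  by under eq_fun do rewrite big_nil; exact: h_cont.
under eq_fun do rewrite big_cons.
exact: (max_fun_continuous (h_cont i) IHr).
Qed.

End Maxf.

(** Normalised so that [a] is the second derivative: the derivative at [s] is [a * s + b], and
    [g_comp] is the case [a = L i * enorm d ^+ 2]. *)
Definition quad (R : realType) (a b s : R) : R := 2^-1 * a * s ^+ 2 + b * s.

Lemma quad_shift (R : realType) (a b s h : R) :
  quad a b (s + h) = quad a b s + (a * s + b) * h + 2^-1 * a * h ^+ 2.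
Proof. by rewrite /quad; field. Qed.

Lemma continuous_quad (R : realType) (a b : R) : continuous (quad a b).
Proof.
move=> s; apply: cvgD; last by apply: cvgM; [exact: cvg_cst | exact: cvg_id].
by apply: cvgM; [exact: cvg_cst | exact: exprn_continuous].
Qed.

(** The lowest nonzero coefficient decides the sign just to the right of 0. Below, [u] is the gap
    between a piece and the maximum, and [v] its directional slope. *)
Lemma poly2_neg_right (R : realType) (u v w : R) :
  u < 0 \/ u = 0 /\ v < 0 -> \forall e \near 0^'+, u + v * e + w * e ^+ 2 < 0.
Proof.
case=> [u_lt0 | [-> v_lt0]].
- have K_gt0 : 0 < `|v| + `|w| + 1 by rewrite ltr_wpDl// addr_ge0.
  near=> e.
  have e_gt0 : 0 < e by near: e; exact: nbhs_right_gt.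
  have e_lt1 : e < 1 by near: e; exact: nbhs_right_lt.
  (* Since [e < 1], the terms in [v] and [w] sum to at most [(|v| + |w|) * e]; the added 1 only
     keeps the divisor positive. *)
  have : e < - u / (`|v| + `|w| + 1).
    by near: e; apply: nbhs_right_lt; rewrite divr_gt0// oppr_gt0.
  rewrite ltr_pdivlMr// => eK.
  have ve : v * e <= `|v| * e by rewrite ler_wpM2r ?ler_norm// ltW.
  have we : w * e ^+ 2 <= `|w| * e.
    rewrite expr2 mulrA (ler_wpM2r (ltW e_gt0))//; apply: le_trans (ler_norm _) _.
    by rewrite normrM (gtr0_norm e_gt0) ler_piMr// ltW.
  lra.
- have K_gt0 : 0 < `|w| + 1 by rewrite ltr_wpDl.
  near=> e.
  have e_gt0 : 0 < e by near: e; exact: nbhs_right_gt.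
  have : e < - v / (`|w| + 1).
    by near: e; apply: nbhs_right_lt; rewrite divr_gt0// oppr_gt0.
  rewrite ltr_pdivlMr// => eK.
  have -> : 0 + v * e + w * e ^+ 2 = e * (v + w * e) by ring.
  have we : w * e <= `|w| * e by rewrite ler_wpM2r ?ler_norm// ltW.
  rewrite pmulr_rlt0//; lra.
Unshelve. all: by end_near. Qed.

Section MaxQuad.
Variables (R : realType) (m : nat) (a b : 'I_m.+1 -> R).

Let g (s : R) : R := maxf (fun i => quad (a i) (b i) s).

(** Inactive pieces stay below [g t] for a small move, active ones drop to first order; as there are
    finitely many pieces, one range of [e] serves all. The sign of [sigma] gives the side of the
    move. *)
Lemma max_quad_descent (t sigma : R) :
  (forall i, quad (a i) (b i) t = g t -> sigma * (a i * t + b i) < 0) ->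
  \forall e \near 0^'+, g (t + sigma * e) < g t.
Proof.
move=> active_lt0.
have near_i (i : 'I_m.+1) :
    \forall e \near 0^'+, quad (a i) (b i) (t + sigma * e) < g t.
  have /(poly2_neg_right (2^-1 * a i * sigma ^+ 2)) : quad (a i) (b i) t - g t < 0 \/
      quad (a i) (b i) t - g t = 0 /\ sigma * (a i * t + b i) < 0.
    have := maxf_ge (fun i => quad (a i) (b i) t) i.
    rewrite -/(g t) le_eqVlt => /predU1P[eq_i|lt_i].
      by right; rewrite eq_i subrr; split=> //; exact: active_lt0.
    by left; rewrite subr_lt0.
  by apply: filterS => e; rewrite quad_shift; nra.
near=> e.
have lt_e i : quad (a i) (b i) (t + sigma * e) < g t.
  by move: i; near: e; exact: filter_forall.
by rewrite {1}/g; have [i ->] := maxf_attained (fun i => quad (a i) (b i) (t + sigma * e)).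
Unshelve. all: by end_near. Qed.

Hypothesis a_gt0 : forall i, 0 < a i.

(** The piece attaining the maximum at the midpoint lies below its own chord by
    [a i * (s - t) ^+ 2 / 8]. *)
Lemma max_quad_midpoint (s t : R) :
  s != t -> g ((s + t) / 2) < (g s + g t) / 2.
Proof.
move=> neq_st; rewrite {1}/g.
have [i ->] := maxf_attained (fun i => quad (a i) (b i) ((s + t) / 2)).
have := maxf_ge (fun i => quad (a i) (b i) s) i.
have := maxf_ge (fun i => quad (a i) (b i) t) i.
rewrite -/(g s) -/(g t) => le_t le_s.
have sq_gt0 : 0 < a i * (s - t) ^+ 2.
  by rewrite mulr_gt0// exprn_even_gt0//= subr_eq0.
have -> : quad (a i) (b i) ((s + t) / 2) =
    (quad (a i) (b i) s + quad (a i) (b i) t) / 2 - a i * (s - t) ^+ 2 / 8.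
  by rewrite /quad; field.
lra.
Qed.

(** Existence comes from the extreme value theorem; two distinct minimizers would be beaten by their
    midpoint. *)
Lemma argmin_max_quad : exists t, argmin `[0, 1] g = [set t].
Proof.
have g_cont : {within `[0, 1], continuous g}.
  apply: continuous_subspaceT.
  by apply: (@continuous_maxf _ _ (fun i => quad (a i) (b i))) => i; exact: continuous_quad.
have [t t01 t_min] := EVT_min ler01 g_cont.
exists t; apply/seteqP; split=> [s [s01 s_min]|_ ->] /=; last by split.
apply/eqP/negPn/negP => /max_quad_midpoint.
have := s_min _ t01; have : ((s + t) / 2) \in `[0, 1].
  by move: s01 t01; rewrite /= !in_itv/= => /andP[? ?] /andP[? ?]; apply/andP; split; lra.
move=> /t_min; have := t_min _ s01; lra.
Qed.

Hypothesis b_lt0 : forall i, b i < 0.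

Lemma argmin_max_quad_candidate (t : R) :
  argmin `[0, 1] g t -> t < 1 ->
  (exists i, a i * t + b i = 0) \/
  (exists i j : 'I_m.+1, [/\ (i < j)%N, a i != a j & (a i - a j) * t = - (2 * (b i - b j))]).
Proof.
case=> /= t01 t_min t_lt1; move: t01; rewrite in_itv /= => /andP[t_ge0 _].
apply/or_asboolP; rewrite -[_ || _]negbK negb_or.
apply/negP => /andP[/asboolPn no_crit /asboolPn no_cross].
have no_descent sigma : (\forall e \near 0^'+, 0 <= t + sigma * e <= 1) ->
    ~ (forall i, quad (a i) (b i) t = g t -> sigma * (a i * t + b i) < 0).
  move=> in01 /max_quad_descent lt_g.
  have [e [e01]] := filter_ex (filterI in01 lt_g).
  by rewrite ltNge t_min//= in_itv.
have right01 : \forall e \near 0^'+, 0 <= t + 1 * e <= 1.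
  near=> e; have e_gt0 : 0 < e by near: e; exact: nbhs_right_gt.
  have : e < 1 - t by near: e; apply: nbhs_right_lt; rewrite subr_gt0.
  by move=> ?; apply/andP; split; lra.
(* At 0 every piece has derivative [b i < 0], so a move to the right would descend. *)
have t_gt0 : 0 < t.
  rewrite lt_neqAle t_ge0 andbT; apply/eqP => t0.
  by apply: (no_descent _ right01) => i _; rewrite -t0 mulr0 add0r mul1r.
have left01 : \forall e \near 0^'+, 0 <= t + -1 * e <= 1.
  near=> e; have e_gt0 : 0 < e by near: e; exact: nbhs_right_gt.
  have : e < t by near: e; exact: nbhs_right_lt.
  by move=> ?; apply/andP; split; lra.
(* Both pieces vanish at 0, so equality of values at [t] can be divided by [t > 0], leaving a linear
   equation. *)
have cross i j : quad (a i) (b i) t = quad (a j) (b j) t ->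
    (a i - a j) * t = - (2 * (b i - b j)).
  rewrite /quad => eq_ij; apply: (mulIf (lt0r_neq0 t_gt0)); lra.
(* With crossings excluded, two active pieces share their leading coefficient, and [cross] then
   forces equal [b]. Hence the derivative of a single active piece [i0] decides on which side all of
   them descend. *)
have active_eq i j : quad (a i) (b i) t = g t -> quad (a j) (b j) t = g t ->
    a i * t + b i = a j * t + b j.
  move=> act_i act_j; have eq_ij := cross i j (etrans act_i (esym act_j)).
  have eq_a : a i = a j.
    apply/eqP/negPn/negP => neq_a; apply: no_cross.
    case: (ltngtP i j) => [lt_ij|lt_ji|/val_inj eq_i]; first by exists i, j.
      by exists j, i; split; rewrite // 1?eq_sym// ; lra.
    by rewrite eq_i eqxx in neq_a.
  by move: eq_ij; rewrite eq_a; lra.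
have [i0 /esym act0] := maxf_attained (fun i => quad (a i) (b i) t).
case: (ltgtP (a i0 * t + b i0) 0) => [lt0|gt0|eq0].
- by apply: (no_descent _ right01) => i act_i; rewrite (active_eq i i0)// mul1r.
- by apply: (no_descent _ left01) => i act_i; rewrite (active_eq i i0)// mulN1r oppr_lt0.
- by apply: no_crit; exists i0.
Unshelve. all: by end_near. Qed.

End MaxQuad.

Section Dotp.
Variables (R : realType) (n : nat).
Implicit Types u v w : 'rV[R]_n.

Lemma dotpBl u v w : dotp (u - v) w = dotp u w - dotp v w.
Proof.
by rewrite /dotp -sumrB; apply: eq_bigr => j _; rewrite !mxE mulrBl.
Qed.

(** If the sum of squares vanished, so would each coordinate of [v], and with them the product. This
    turns a negative slope into a nonzero direction. *)
Lemma sqr_enorm_gt0 u v : dotp u v != 0 -> 0 < enorm v ^+ 2.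
Proof.
have sq_ge0 j : 0 <= v ord0 j * v ord0 j by rewrite -expr2 sqr_ge0.
have vv_ge0 : 0 <= dotp v v by apply: sumr_ge0.
rewrite /enorm sqr_sqrtr// lt_neqAle vv_ge0 andbT (eq_sym 0); apply: contraNN.
rewrite psumr_eq0// => /allP v0.
rewrite /dotp big1// => j _; have := v0 j (mem_index_enum j).
by rewrite mulf_eq0 orbb => /eqP ->; rewrite mulr0.
Qed.

End Dotp.

Theorem proposition3p7 (R : realType) (n m : nat)
    (F : 'rV[R]_n -> 'rV[R]_m.+1) (Omega : set 'rV[R]_n) (L : 'I_m.+1 -> R)
    (p : 'rV[R]_n -> 'rV[R]_n) (x : nat -> 'rV[R]_n) (t : nat -> R)
    (F_C1 : continuously_differentiable F)
    (Omega_neq0 : Omega !=set0)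
    (Omega_compact : compact Omega)
    (Omega_convex : convex_set Omega)
    (L_gt0 : forall i, 0 < L i)
    (grad_lip : forall i y z, Omega y -> Omega z ->
      enorm (grad (component F i) y - grad (component F i) z)
        <= L i * enorm (y - z))
    (p_sel : is_selection F Omega p)
    (x_seq : MCondG_sequence Omega p x t)
    (nonterm : forall k, theta F p (x k) < 0) :
  forall k, exists tTAS : R,
    argmin `[0, 1] (g_max F L (x k) (direction p (x k))) = [set tTAS] /\
    (C_set F L (x k) (direction p (x k)) `&` `[0, 1]) tTAS.
Proof.
move=> k; set d := direction p (x k).
have slope_lt0 i : slope F (x k) d i < 0.
  by apply: le_lt_trans (nonterm k); exact: maxf_ge.
have d2_gt0 : 0 < enorm d ^+ 2 := sqr_enorm_gt0 (negbT (lt_eqF (slope_lt0 ord0))).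
pose a i := L i * enorm d ^+ 2.
have a_gt0 i : 0 < a i by rewrite mulr_gt0.
have -> : g_max F L (x k) d =
    (fun s => maxf (fun i => quad (a i) (slope F (x k) d i) s)).
  apply/funext => s; congr maxf; apply/funext => i.
  by rewrite /g_comp /quad /a !mulrA.
have [t0 argmin_t0] := argmin_max_quad (slope F (x k) d) a_gt0.
exists t0; split=> //.
have t0_min : argmin `[0, 1]
    (fun s => maxf (fun i => quad (a i) (slope F (x k) d i) s)) t0.
  by rewrite argmin_t0.
have t0_01 := t0_min.1; split=> //.
move: t0_01; rewrite /= in_itv/= => /andP[_]; rewrite le_eqVlt => /predU1P[->|t0_lt1].
  by left; left.
have [[i crit]|[i [j [lt_ij neq_a cross]]]] :=
    argmin_max_quad_candidate slope_lt0 t0_min t0_lt1.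
- left; right; exists i => //=; rewrite -/(a i).
  (* Clearing the denominator [a i] of the [M_set] element leaves the stationarity equation. *)
  apply: (mulfI (lt0r_neq0 (a_gt0 i))).
  by rewrite mulrN mulrC divfK ?lt0r_neq0//; lra.
- have neq_L : L i != L j by apply: contraNneq neq_a => eq_L; rewrite /a eq_L.
  right; exists i, j; split=> //.
  have a_neq0 : a i - a j != 0 by rewrite subr_eq0.
  (* The denominator in [I_set] expands to [a i - a j], so clearing it leaves the crossing
     equation. *)
  rewrite mulrBl dotpBl; apply: (mulfI a_neq0).
  by rewrite cross mulrN [X in _ = - X]mulrC divfK.
Qed.
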